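(* Let $d\ge 0$ be an integer, let $G$ be a graph on $n$ vertices and let $A$ be a real symmetric matrix with rows and columns indexed by $V(G)$ such that $|A_{u,v}|\le 1$ for all $u,v$, and $A_{u,v}=0$ whenever $u\not\sim v$ (in particular $A_{u,u}=0$). Then $$\chi^d(G)\ \ge\ \left\lceil \max\left\{\frac{n}{n-n_d^+(A)},\ \frac{n}{n-n_d^-(A)}\right\}\right\rceil .$$
   Context: Graphs are finite, simple, with at least one vertex. A colouring of $G$ is $d$-improper if each vertex $v$ has at most $d$ neighbours of the same colour as $v$; $\chi^d(G)$ is the least number of colours in a $d$-improper colouring of $G$. $n_d^+(A)$ is the number of eigenvalues of $A$ (counted with multiplicity) that are strictly greater than $d$, and $n_d^-(A)$ is the number of eigenvalues of $A$ (counted with multiplicity) that are strictly smaller than $-d$. *)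

(* Defs.v *)
From HB Require Import structures.
From mathcomp Require Import all_boot all_order all_algebra.
From mathcomp Require Import polyrcf.
From mathcomp Require Import reals.

Set Implicit Arguments.
Unset Strict Implicit.
Unset Printing Implicit Defensive.

Import Order.TTheory GRing.Theory Num.Theory.

Record sgraph := SGraph {
  vertex :> finType;
  adj : rel vertex;
  adj_sym : symmetric adj;
  adj_irrefl : irreflexive adj;
  vertex_gt0 : 0 < #|vertex|
}.

Arguments adj {s}.

Section ImproperColouring.
Variables (d : nat) (G : sgraph).

Definition improper_colouring k (c : {ffun G -> 'I_k}) : bool :=
  [forall v, #|[set u | adj v u & c u == c v]| <= d].

Definition improper_colourable k : bool :=
  [exists c : {ffun G -> 'I_k}, improper_colouring c].

Lemma improper_colourable_ex : exists k, improper_colourable k.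
Proof.
exists #|G|; apply/existsP; exists [ffun v => enum_rank v].
apply/forallP => v; apply: (@leq_trans 0); rewrite ?leq0n // leqn0 cards_eq0.
apply/eqP/setP => u; rewrite !inE !ffunE (inj_eq enum_rank_inj).
by case: eqVneq => [->|_]; rewrite ?adj_irrefl ?andbF.
Qed.

Definition improper_chromatic_number : nat := ex_minn improper_colourable_ex.

End ImproperColouring.

Section EigenvalueCount.
Local Open Scope ring_scope.
Variables (R : rcfType) (n : nat).
Implicit Types A : 'M[R]_n.

(* The distinct eigenvalues of A in R; [mup x (char_poly A)] is the            *)
(* multiplicity of x as a root of the characteristic polynomial.              *)
Definition eigenvalues A : seq R := rootsR (char_poly A).

Lemma mem_eigenvalues A x : (x \in eigenvalues A) = eigenvalue A x.
Proof.
have /roots_on_rootsR/(_ x) : char_poly A != 0 by rewrite monic_neq0 ?char_poly_monic.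
by rewrite eigenvalue_root_char => <-; rewrite in_itv.
Qed.

Definition neig_gt (d : nat) A : nat :=
  (\sum_(x <- eigenvalues A | (d%:R < x)%R) mup x (char_poly A))%N.

Definition neig_lt (d : nat) A : nat :=
  (\sum_(x <- eigenvalues A | (x < - d%:R)%R) mup x (char_poly A))%N.

End EigenvalueCount.

(* Main.v *)
Require Import Defs.
From HB Require Import structures.
From mathcomp Require Import all_boot all_order all_algebra.
From mathcomp Require Import polyrcf.
From mathcomp Require Import reals.
From mathcomp Require Import spectral complex.

Set Implicit Arguments.
Unset Strict Implicit.
Unset Printing Implicit Defensive.

Import Order.TTheory GRing.Theory Num.Theory.
Local Open Scope ring_scope.
Local Open Scope sesquilinear_scope.

(** Let [W] be the span of the eigenvectors of [A] whose eigenvalue exceeds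
    [d], a space of dimension [n^+], and let [S] be a colour class of a
    [d]-improper colouring. On nonzero vectors of [W] the quadratic form of [A]
    is larger than [d] times the squared norm. On vectors supported in [S] it
    is at most [d] times the squared norm in absolute value, since the rows of
    the principal submatrix on [S] have absolute sum at most [d]
    ([form_bound]). So [W] meets the coordinate space of [S] only in [0], and
    [#|S| + n^+ <= n] ([card_spectral_gt_bound]). Summing over the [k] colour
    classes gives [n + k n^+ <= k n], that is [n / (n - n^+) <= k]. Replacing
    [A] by [- A] gives the same for [n^-].

    The spectral theorem is applied to [A] as a Hermitian matrix over [R[i]],
    so the forms are Hermitian forms over [R[i]]. The eigenvalues are real, hence they are also the roots
    of the characteristic polynomial over [R] ([real_spectral]), and the sum
    of multiplicities of those that satisfy a condition is the number of
    diagonal entries that satisfy it ([sum_mup_rootsR]). *)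

(** * Characteristic polynomials and root multiplicities *)

Lemma char_poly_similar (F : fieldType) m (P A B : 'M[F]_m) :
  P \in unitmx -> P *m A = B *m P -> char_poly A = char_poly B.
Proof.
move=> Pu PAB.
have PX : map_mx polyC P *m char_poly_mx A = char_poly_mx B *m map_mx polyC P.
  rewrite /char_poly_mx mulmxBr mulmxBl -!map_mxM PAB.
  by rewrite mul_mx_scalar mul_scalar_mx.
have detP0 : \det (map_mx polyC P) != 0.
  by rewrite det_map_mx polyC_eq0 -unitfE -unitmxE.
by apply: (mulfI detP0); rewrite /char_poly -det_mulmx PX det_mulmx mulrC.
Qed.

Lemma mup_prod_XsubC (F : fieldType) m (r : 'I_m -> F) x :
  mup x (\prod_i ('X - (r i)%:P)) = (\sum_i (r i == x))%N.
Proof.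
apply: (proj2 (A := \prod_i ('X - (r i)%:P) != 0) _).
elim/big_rec2: _ => [|i k p _ [p0 IH]].
  by rewrite oner_neq0 mupNroot // root1.
rewrite mulf_neq0 ?polyXsubC_eq0 // mupM ?polyXsubC_eq0 // IH.
by rewrite -['X - _]expr1 mup_XsubCX; case: eqP.
Qed.

Lemma sum_mup_rootsR (R : rcfType) m (r : 'I_m -> R) (p : {poly R})
    (Q : pred R) :
  p = \prod_i ('X - (r i)%:P) ->
  (\sum_(x <- rootsR p | Q x) mup x p)%N = #|[set i | Q (r i)]|.
Proof.
move=> pE.
have p0 : p != 0 by rewrite pE monic_neq0 // monic_prod_XsubC.
under eq_bigr do rewrite {1}pE mup_prod_XsubC.
rewrite exchange_big -sum1dep_card [RHS]big_mkcond; apply: eq_bigr => i _ /=.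
have ri : r i \in rootsR p.
  have := roots_on_rootsR p0 (r i); rewrite in_itv /= => <-.
  by rewrite pE /root horner_prod (bigD1 i) //= !hornerE subrr mul0r.
rewrite big_mkcond (bigD1_seq (r i)) ?uniq_roots //= eqxx big1 ?addn0 //.
by move=> x /negPf xr; rewrite eq_sym xr; case: ifP.
Qed.

(** * Quadratic forms and coordinate subspaces *)

Section SpectralSubspace.
Variables (C : numClosedFieldType) (m : nat).
Implicit Types (A P : 'M[C]_m) (D x : 'rV[C]_m) (S : {set 'I_m}).

Lemma form_diag D x :
  (x *m diag_mx D *m x^t*) 0 0 = \sum_i D 0 i * `|x 0 i| ^+ 2.
Proof.
rewrite mxE; apply: eq_bigr => i _.
by rewrite mul_mx_diag !mxE normCK mulrAC mulrC mulrA.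
Qed.

(** The row-sum bound on the numerical range of the principal submatrix on [S]:
    each product [|x_u| |x_v|] is at most the mean of the two squares, and by
    symmetry of [A] each square then collects a full row sum. *)
Lemma form_bound A S (t : C) x :
  A^T = A ->
  (forall u, u \in S -> \sum_(v in S) `|A u v| <= t) ->
  (forall u, u \notin S -> x 0 u = 0) ->
  `|(x *m A *m x^t*) 0 0| <= t * \sum_u `|x 0 u| ^+ 2.
Proof.
move=> Asym rowA suppx.
have -> : (x *m A *m x^t*) 0 0
    = \sum_(u in S) \sum_(v in S) x 0 u * A u v * (x 0 v)^*.
  rewrite mxE (bigID (mem S)) /= [X in _ + X]big1 ?addr0; last first.
    by move=> v vS; rewrite !mxE suppx // conjC0 mulr0.
  rewrite exchange_big; apply: eq_bigr => v vS /=.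
  rewrite !mxE (bigID (mem S)) /= [X in _ + X]big1 ?addr0; last first.
    by move=> u uS; rewrite suppx // mul0r.
  by rewrite mulr_suml.
have -> : \sum_u `|x 0 u| ^+ 2 = \sum_(u in S) `|x 0 u| ^+ 2.
  rewrite (bigID (mem S)) /= [X in _ + X]big1 ?addr0 // => u uS.
  by rewrite suppx // normr0 expr0n.
pose a u v := `|A u v|.
have aC u v : a u v = a v u by rewrite /a -[in LHS]Asym mxE.
apply: le_trans (ler_norm_sum _ _ _) _.
apply: (@le_trans _ _ (\sum_(u in S) \sum_(v in S)
    (a u v * `|x 0 u| ^+ 2 + a u v * `|x 0 v| ^+ 2) / 2)).
  apply: ler_sum => u uS; apply: le_trans (ler_norm_sum _ _ _) _.
  apply: ler_sum => v vS; rewrite !normrM norm_conjC.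
  rewrite ler_pdivlMr ?ltr0n // -mulrDr [`|x 0 u| * _]mulrC -!mulrA.
  apply: ler_wpM2l; first exact: normr_ge0.
  rewrite -subr_ge0; apply: le_trans (_ : 0 <= (`|x 0 u| - `|x 0 v|) ^+ 2) _.
    by rewrite real_exprn_even_ge0 // rpredB // normr_real.
  by rewrite sqrrB mulr_natr mulrnAr addrAC.
under eq_bigr do rewrite -mulr_suml big_split.
rewrite -mulr_suml big_split /= [X in _ + X]exchange_big /=.
rewrite [X in _ + X](_ : _ = \sum_(u in S) \sum_(v in S) a u v * `|x 0 u| ^+ 2).
  rewrite -mulr2n -[X in X / _]mulr_natr mulfK ?pnatr_eq0 // mulr_sumr.
  apply: ler_sum => u uS; rewrite -mulr_suml.
  by apply: ler_wpM2r; rewrite ?exprn_ge0 ?rowA.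
by apply: eq_bigr => u _; apply: eq_bigr => v _; rewrite aC.
Qed.

(** The coordinate space of [S] and the span of the eigenvectors for
    eigenvalues above [t] intersect trivially: a common vector [x] has
    eigenvector coordinates [y] with
    [\sum_i (D 0 i - t) * `|y 0 i| ^+ 2 <= 0], while each term is
    nonnegative and vanishes only with [y 0 i]. *)
Lemma card_spectral_gt_bound A P D S (t : C) :
  P \is unitarymx -> A = P^t* *m diag_mx D *m P -> 0 <= t ->
  (forall x, (forall u, u \notin S -> x 0 u = 0) ->
     `|(x *m A *m x^t*) 0 0| <= t * \sum_u `|x 0 u| ^+ 2) ->
  (#|S| + #|[set i | (t < D 0 i)%R]| <= m)%N.
Proof.
move=> Pu AE t0 bnd; set T := [set i | _].
pose rows (M : 'M[C]_m) (X : {set 'I_m}) : 'M_(#|X|, m) := rowsub enum_val M.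
have rk M X : M \is unitarymx -> \rank (rows M X) = #|X|.
  move=> Mu; apply: mxrank_unitary; apply/row_unitarymxP => i j.
  by rewrite !row_rowsub (row_unitarymxP Mu) (inj_eq enum_val_inj).
have supp (X : {set 'I_m}) (b : 'rV_#|X|) u :
    u \notin X -> (b *m rows 1%:M X) 0 u = 0.
  move=> uX; rewrite mxE big1 // => k _; rewrite !mxE.
  by case: eqP => [ku|]; rewrite ?mulr0 //; rewrite -ku enum_valP in uX.
have one : 1%:M \is @unitarymx C m m.
  by apply/unitarymxP; rewrite mul1mx trmx1 map_mx1.
rewrite -(rk 1%:M S) // -(rk P T) // -mxrank_disjoint_sum ?rank_leq_col //.
apply/eqP/rowV0P => x; rewrite sub_capmx => /andP[/submxP[a xa] /submxP[b xb]].
have xS u : u \notin S -> x 0 u = 0 by rewrite xa; apply: supp.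
(* The coordinates of [x] in the orthonormal basis formed by the rows of [P]. *)
pose y := b *m rows 1%:M T.
have xy : x = y *m P by rewrite xb -mulmxA mul_rowsub_mx mul1mx.
have yT u : u \notin T -> y 0 u = 0 by apply: supp.
have fA : (x *m A *m x^t*) 0 0 = \sum_i D 0 i * `|y 0 i| ^+ 2.
  rewrite -form_diag xy AE trmx_mul map_mxM !mulmxA.
  by rewrite !mulmxtVK.
have f1 : \sum_u `|x 0 u| ^+ 2 = \sum_i `|y 0 i| ^+ 2.
  transitivity ((x *m x^t*) 0 0).
    by rewrite mxE; apply: eq_bigr => u _; rewrite !mxE normCK.
  rewrite xy trmx_mul map_mxM !mulmxA mulmxtVK // mxE.
  by apply: eq_bigr => u _; rewrite !mxE normCK.
have ge0 i : 0 <= (D 0 i - t) * `|y 0 i| ^+ 2.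
  have [iT|/yT->] := boolP (i \in T); last by rewrite normr0 expr0n mulr0.
  by rewrite mulr_ge0 ?exprn_ge0 // subr_ge0 ltW //; rewrite inE in iT.
have sumE : \sum_i (D 0 i - t) * `|y 0 i| ^+ 2
    = (x *m A *m x^t*) 0 0 - t * \sum_u `|x 0 u| ^+ 2.
  rewrite fA f1 mulr_sumr -sumrB; apply: eq_bigr => i _.
  by rewrite mulrBl.
have fA0 : 0 <= (x *m A *m x^t*) 0 0.
  rewrite -[X in 0 <= X](subrK (t * \sum_u `|x 0 u| ^+ 2)) -sumE.
  by rewrite addr_ge0 ?sumr_ge0 ?mulr_ge0 ?sumr_ge0 // => *; rewrite exprn_ge0.
have sum0 : \sum_i (D 0 i - t) * `|y 0 i| ^+ 2 = 0.
  apply/eqP; rewrite eq_le sumr_ge0 ?andbT // sumE subr_le0.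
  by rewrite -{1}(ger0_norm fA0) bnd.
rewrite xy [y](_ : _ = 0) ?mul0mx //; apply/rowP => i; rewrite [RHS]mxE.
have [iT|/yT//] := boolP (i \in T).
have /eqP := psumr_eq0P (fun j _ => ge0 j) sum0 (i := i) isT.
rewrite mulf_eq0 subr_eq0 expf_eq0 normr_eq0 /=.
by rewrite inE in iT; rewrite (gt_eqF iT) /= => /eqP.
Qed.

End SpectralSubspace.

(** * Eigenvalue counts of real symmetric matrices *)

Section RealSymmetric.
Variables (R : rcfType) (m : nat) (A : 'M[R]_m).
Hypothesis A_sym : A^T = A.

(** The eigenvectors are taken over [R[i]] and the eigenvalues in [R]; the
    factorisation of the characteristic polynomial comes down from [R[i]] to
    [R] because the embedding is injective on polynomials. *)
Lemma real_spectral :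
  exists (P : 'M[R[i]]_m) (r : 'I_m -> R),
    [/\ P \is unitarymx,
        map_mx (real_complex R) A
          = P^t* *m diag_mx (\row_i (r i)%:C%C) *m P
      & char_poly A = \prod_i ('X - (r i)%:P)].
Proof.
pose B := map_mx (real_complex R) A.
have Bherm : B \is hermsymmx.
  apply: realsym_hermsym.
    by apply/is_hermitianmxP; rewrite expr0 scale1r map_mx_id // map_trmx A_sym.
  by apply/mxOverP => i j; rewrite mxE; apply/complex_realP; exists (A i j).
have Dreal := hermitian_spectral_diag_real Bherm.
have Pu := spectral_unitarymx B.
have /orthomx_spectralP BE := hermitian_normalmx Bherm.
set P := spectralmx B in Pu BE *.
pose r i := complex.Re (spectral_diag B 0 i).
have DE : spectral_diag B = \row_i (r i)%:C%C.
  by apply/rowP => i; rewrite mxE RRe_real //; apply: (mxOverP Dreal).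
rewrite DE invmx_unitary // in BE.
exists P, r; split=> //.
apply: (map_poly_inj (real_complex R)).
rewrite map_char_poly -/B rmorph_prod.
have -> : char_poly B = char_poly (diag_mx (\row_i (r i)%:C%C)).
  apply: (@char_poly_similar _ _ P); first exact: unitarymx_unit.
  by rewrite [in LHS]BE !mulmxA (unitarymxP Pu) mul1mx.
rewrite char_poly_trig ?diag_mx_is_trig //; apply: eq_bigr => i _.
by rewrite rmorphB /= map_polyX map_polyC !mxE eqxx.
Qed.

Variables (S : {set 'I_m}) (d : nat).
Hypothesis rowA : forall u, u \in S -> \sum_(v in S) `|A u v| <= d%:R.

Lemma card_neig_bound :
  (#|S| + neig_gt d A <= m)%N /\ (#|S| + neig_lt d A <= m)%N.
Proof.
have [P [r [Pu AE chA]]] := real_spectral.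
rewrite /neig_gt /neig_lt /eigenvalues !(sum_mup_rootsR _ chA).
set B := map_mx _ A in AE.
have bnd (x : 'rV_m) : (forall u, u \notin S -> x 0 u = 0) ->
    `|(x *m B *m x^t*) 0 0| <= d%:R * \sum_u `|x 0 u| ^+ 2.
  apply: form_bound; first by rewrite map_trmx A_sym.
  move=> u /rowA; rewrite -lecR rmorph_nat rmorph_sum /=.
  apply: le_trans; apply: ler_sum => v _.
  by rewrite mxE normc_def /= expr0n addr0 sqrtr_sqr.
split.
  have := card_spectral_gt_bound Pu AE (ler0n _ d) bnd; congr (_ + _ <= _)%N.
  by apply: eq_card => i; rewrite !inE mxE -(rmorph_nat (real_complex R)) ltcR.
(* Eigenvalues of [B] below [- d] are eigenvalues of [- B] above [d]. *)
have NE : - B = P^t* *m diag_mx (- \row_i (r i)%:C%C) *m P.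
  by rewrite AE linearN /= mulmxN mulNmx.
have := card_spectral_gt_bound Pu NE (ler0n _ d) _.
rewrite (_ : [set i | _] = [set i | r i < - d%:R]); last first.
  apply/setP => i; rewrite !inE !mxE -(rmorph_nat (real_complex R)) -rmorphN.
  by rewrite ltcR ltrNr.
by apply=> x /bnd le_x; rewrite mulmxN mulNmx mxE normrN.
Qed.

End RealSymmetric.

(** * The bound on the improper chromatic number *)

Lemma ratio_le (R : realType) (n q k : nat) :
  (q < n)%N -> (n + k * q <= k * n)%N ->
  n%:R / (n%:R - q%:R) <= k%:R :> R.
Proof.
move=> qn h; rewrite ler_pdivrMr ?subr_gt0 ?ltr_nat //.
by rewrite mulrBr lerBrDr -!natrM -natrD ler_nat.
Qed.

Theorem corollary14 (R : realType) (d : nat) (G : sgraph) (n : nat)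
    (hn : #|G| = n) (A : 'M[R]_#|G|)
    (A_sym : A^T = A)
    (A_le1 : forall u v : G, `|A (enum_rank u) (enum_rank v)| <= 1)
    (A_nadj : forall u v : G,
       ~~ adj u v -> A (enum_rank u) (enum_rank v) = 0) :
  Num.ceil (Num.max (n%:R / (n%:R - (neig_gt d A)%:R) : R)
                    (n%:R / (n%:R - (neig_lt d A)%:R) : R))
    <= (improper_chromatic_number d G)%:Z.
Proof.
rewrite /improper_chromatic_number.
case: ex_minnP => k /existsP[c /forallP c_imp] _.
pose S j := [set i : 'I_#|G| | c (enum_val i) == j].
have rowS j u : u \in S j -> \sum_(v in S j) `|A u v| <= d%:R.
  rewrite inE => /eqP cu; pose w := enum_val u.
  have /(le_trans _) -> // : #|[set v | adj w v & c v == c w]|%:R <= d%:R :> R.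
    by rewrite ler_nat c_imp.
  rewrite (reindex enum_rank) /=; last first.
    by apply: onW_bij; apply: enum_rank_bij.
  rewrite -sum1dep_card natr_sum (big_mkcond (fun _ => _ && _)) /=.
  rewrite big_mkcond; apply: ler_sum => v _.
  rewrite inE enum_rankK cu -[u]enum_valK -/w; case: eqP => _; last first.
    by rewrite andbF.
  by rewrite andbT; case: (boolP (adj w v)) => [_|/A_nadj->]; rewrite ?normr0.
have bnd j := card_neig_bound A_sym (rowS j).
have sumS : (\sum_j #|S j|)%N = #|G|.
  transitivity #|'I_#|G| |; last exact: card_ord.
  rewrite -[RHS]sum1_card (partition_big (c \o enum_val) xpredT) //=.
  by apply: eq_bigr => j _; rewrite -sum1dep_card.
have ratio q : (forall j, #|S j| + q <= #|G|)%N ->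
    n%:R / (n%:R - q%:R) <= k%:R :> R.
  move=> Sq; apply: ratio_le; rewrite -hn.
    (* The class of any vertex is nonempty, so the denominator is positive. *)
    have /card_gt0P[v _] := vertex_gt0 G.
    apply: leq_trans (Sq (c v)); rewrite -add1n leq_add2r card_gt0.
    by apply/set0Pn; exists (enum_rank v); rewrite inE enum_rankK.
  have := leq_sum (index_enum _) (P := xpredT) (fun j _ => Sq j).
  by rewrite big_split /= sumS !sum_nat_const card_ord.
rewrite ceil_le_int ge_max !ratio // => j; by have [] := bnd j.
Qed.
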